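(* Let $n\ge 1$ and $m\ge 0$ be integers and let $\lambda_1,\dots,\lambda_{n+1}$ be independent variables (commuting indeterminates). Then $$\sum_{\sigma\in S_{n+1}}\lambda_{\sigma(1)}^m\prod_{k=1}^n\frac{\lambda_{\sigma(1)}-\lambda_{\sigma(k+1)}}{\lambda_{\sigma(k)}-\lambda_{\sigma(k+1)}}=\lambda_1^m+\cdots+\lambda_{n+1}^m.$$
   Context: $S_{n+1}$ denotes the symmetric group of all permutations of $\{1,2,\dots,n+1\}$. The identity is one of rational functions (over $\mathbb{Q}$) in the indicated indeterminates. *)

(* Defs.v *)
From HB Require Import structures.
From mathcomp Require Import all_boot all_order all_algebra all_fingroup.
From mathcomp Require Import mpoly.

Set Implicit Arguments.
Unset Strict Implicit.
Unset Printing Implicit Defensive.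

Import GRing.Theory.
Local Open Scope ring_scope.

(* The field Q(X_0, ..., X_{N-1}). *)
Definition ratfun (N : nat) : fieldType := {fraction {mpoly rat[N]}}.

Definition indet (N : nat) (i : 'I_N) : ratfun N := tofrac ('X_i : {mpoly rat[N]}).

(* Distinct indeterminates have a nonzero difference, so no quotient of the
   form _ / (indet i - indet j) with i != j relies on the convention
   0^-1 = 0. *)
Lemma indet_inj (N : nat) : injective (@indet N).
Proof.
move=> i j /eqP; rewrite -subr_eq0 /indet -tofracB tofrac_eq0 subr_eq0.
move=> /eqP /(congr1 (mcoeff U_(i))); rewrite !mcoeffXU eqxx.
by case: (j =P i) => // _ /eqP; rewrite oner_eq0.
Qed.

(* Main.v *)
(** Fix sigma(1) = i: the numerators contribute the constant
    \prod_(j != i) (x_i - x_j), so it suffices that the chain products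
    \prod_k 1 / (x_(sigma k) - x_(sigma (k+1))), summed over all sigma starting
    at i, give \prod_(j != i) 1 / (x_i - x_j).  This follows by induction on the
    number of indices: splitting according to sigma(2) = j reduces the claim to
    the partial fraction expansion of \prod_j 1 / (x - x_j) at x = x_i, i.e. to
    Lagrange interpolation of the constant polynomial 1. *)
Require Import Defs.
From HB Require Import structures.
From mathcomp Require Import all_boot all_order all_algebra all_fingroup.
From mathcomp Require Import mpoly.

Set Implicit Arguments.
Unset Strict Implicit.
Unset Printing Implicit Defensive.

Import GRing.Theory.
Local Open Scope ring_scope.

Lemma big_lift_perm (R : Type) (idx : R) (op : Monoid.com_law idx) (n : nat)
    (i j : 'I_n.+1) (G : 'S_n.+1 -> R) :
  \big[op/idx]_(s : 'S_n.+1 | s i == j) G s =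
  \big[op/idx]_(t : 'S_n) G (lift_perm i j t).
Proof.
rewrite (reindex (lift_perm i j)).
  by apply: eq_bigl => t; rewrite lift_perm_id eqxx.
(* [u s] is the map induced by [s] from the complement of [i] to that of [s i], both identified with
   ['I_n]. As [s] is injective, [unlift] succeeds and the default [k] is never taken. *)
pose u (s : 'S_n.+1) (k : 'I_n) : 'I_n := odflt k (unlift (s i) (s (lift i k))).
have uK (s : 'S_n.+1) k : lift (s i) (u s k) = s (lift i k).
  rewrite /u; have := neq_lift i k.
  by rewrite -(inj_eq (@perm_inj _ s)) => /unlift_some[? ? ->].
have u_inj s : injective (u s).
  by move=> k k' /(congr1 (lift (s i))); rewrite !uK => /perm_inj /lift_inj.
exists (fun s => perm (@u_inj s)) => [t _ | s].
  by apply/permP => k; rewrite permE /u lift_perm_lift lift_perm_id liftK.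
rewrite inE => /eqP sij; apply/permP => k.
case: (unliftP i k) => [k'|] ->; last by rewrite lift_perm_id.
by rewrite lift_perm_lift -sij permE uK.
Qed.

Lemma big_neq_lift (R : Type) (idx : R) (op : Monoid.com_law idx) (n : nat)
    (i : 'I_n.+1) (G : 'I_n.+1 -> R) :
  \big[op/idx]_(j < n.+1 | j != i) G j = \big[op/idx]_(k < n) G (lift i k).
Proof.
rewrite (reindex_omap (lift i) (unlift i)) => [|j].
  by apply: eq_bigl => k; rewrite liftK eqxx eq_sym neq_lift.
by rewrite eq_sym => /unlift_some[k -> ->].
Qed.

(** As polynomials in [x], both sides have degree at most [n] and agree at the [n.+1] distinct
    points [f i]. *)
Lemma sum_lagrange (F : fieldType) (n : nat) (f : 'I_n.+1 -> F) (x : F) :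
  injective f ->
  \sum_j \prod_(l | l != j) ((x - f l) / (f j - f l)) = 1.
Proof.
move=> f_inj.
pose p j : {poly F} := \prod_(l | l != j) ((f j - f l)^-1 *: ('X - (f l)%:P)).
have pE j y : (p j).[y] = \prod_(l | l != j) ((y - f l) / (f j - f l)).
  by rewrite horner_prod; apply: eq_bigr => l _; rewrite !hornerE mulrC.
have size_p j : (size (p j) <= n.+1)%N.
  rewrite /p big_neq_lift scaler_prod (leq_trans (size_scale_leq _ _)) //.
  by rewrite size_prod_XsubC [index_enum _]unlock -enumT size_enum_ord.
have /eqP : \sum_j p j - 1 = 0.
  apply: (@roots_geq_poly_eq0 _ _ [seq f i | i <- enum 'I_n.+1]).
  - apply/allP => _ /mapP[i _ ->].
    rewrite /root !hornerE horner_sum (bigD1 i) //= pE big1 => [|l li].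
      rewrite big1 ?addr0 ?subrr // => j ji.
      by rewrite pE (bigD1 i) 1?eq_sym //= subrr !mul0r.
    by rewrite divff // subr_eq0 (inj_eq f_inj) eq_sym.
  - by rewrite map_inj_uniq ?enum_uniq.
  - rewrite size_map size_enum_ord (leq_trans (size_polyD _ _)) // geq_max.
    rewrite size_polyN size_poly1 andbT (leq_trans (size_sum _ _ _)) //.
    by apply/bigmax_leqP.
rewrite subr_eq0 => /eqP /(congr1 (fun q : {poly F} => q.[x])).
rewrite horner_sum hornerE => sum1; rewrite -[RHS]sum1.
by apply: eq_bigr => j _; rewrite pE.
Qed.

(** Multiply [sum_lagrange] by the right-hand side: in the [j]-th term every factor [x - f l] with
    [l != j] cancels. *)
Lemma partial_fraction_prod (F : fieldType) (n : nat) (f : 'I_n.+1 -> F)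
    (x : F) :
  injective f -> (forall j, x != f j) ->
  \sum_j (x - f j)^-1 * \prod_(l | l != j) (f j - f l)^-1 =
  \prod_j (x - f j)^-1.
Proof.
move=> f_inj xf.
have sum1 := sum_lagrange x f_inj.
rewrite -[RHS]mulr1 -[X in _ = _ * X]sum1 mulr_sumr.
apply: eq_bigr => j _; rewrite [\prod_i (x - f i)^-1](bigD1 j) //= -mulrA;
  congr (_ * _).
rewrite -big_split /=; apply: eq_bigr => l _.
by rewrite mulKf // subr_eq0.
Qed.

Lemma sum_perm_chain (F : fieldType) (n : nat) (f : 'I_n.+1 -> F)
    (i : 'I_n.+1) :
  injective f ->
  \sum_(s : 'S_n.+1 | s ord0 == i)
     \prod_(k < n) (f (s (widen_ord (leqnSn n) k)) - f (s (lift ord0 k)))^-1 =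
  \prod_(j | j != i) (f i - f j)^-1.
Proof.
elim: n f i => [|n IHn] f i f_inj.
  by rewrite big_lift_perm big_neq_lift big_ord0 (bigD1 1%g) //= big_ord0
             big1 ?addr0 // => t; rewrite permS0 eqxx.
pose g k := f (lift i k).
have g_inj : injective g by move=> k l /f_inj /lift_inj.
rewrite big_lift_perm big_neq_lift -/g.
rewrite -(partial_fraction_prod g_inj) => [|j]; last first.
  by rewrite (inj_eq f_inj) neq_lift.
(* With [t ord0 = j], the first link of the chain is [(f i - g j)^-1]; the remaining links form the
   chain of [t] for [g]. *)
rewrite (partition_big (fun t : 'S_n.+1 => t ord0) xpredT) //=.
apply: eq_bigr => j _; rewrite -IHn // mulr_sumr.
apply: eq_bigr => t /eqP tj; rewrite big_ord_recl.
have -> : widen_ord (leqnSn n.+1) ord0 = ord0 by apply: val_inj.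
rewrite lift_perm_id lift_perm_lift tj; congr (_ * _).
apply: eq_bigr => k _.
have -> : widen_ord (leqnSn n.+1) (lift ord0 k) =
          lift ord0 (widen_ord (leqnSn n) k) by apply: val_inj.
by rewrite !lift_perm_lift.
Qed.

(* Indices are shifted by one: the paper's sigma(1), sigma(k), sigma(k+1) for
   1 <= k <= n are sigma ord0, sigma (widen_ord _ k), sigma (lift ord0 k) for
   k : 'I_n. *)
Theorem corollary12 (n m : nat) (hn : (1 <= n)%N) :
  \sum_(sigma : 'S_n.+1)
     indet (sigma ord0) ^+ m *
     \prod_(k < n)
        ((indet (sigma ord0) - indet (sigma (lift ord0 k))) /
         (indet (sigma (widen_ord (leqnSn n) k)) -
          indet (sigma (lift ord0 k)))) =
  \sum_(i < n.+1) indet i ^+ m.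
Proof.
have x_inj := @indet_inj n.+1.
rewrite (partition_big (fun s : 'S_n.+1 => s ord0) xpredT) //=.
apply: eq_bigr => i _.
pose c := \prod_(j | j != i) (indet i - indet j).
have c_neq0 : c != 0.
  by apply/prodf_neq0 => j ji; rewrite subr_eq0 (inj_eq x_inj) eq_sym.
transitivity (indet i ^+ m * (c * c^-1)); last by rewrite divff ?mulr1.
(* Only [c^-1] becomes a sum over chains; the other [c] is kept to match the numerators. *)
rewrite {2}/c -prodfV -(sum_perm_chain i x_inj) !mulr_sumr.
apply: eq_bigr => s /eqP si; rewrite big_split /= si; congr (_ * (_ * _)).
(* Since [s ord0 = i], [s] maps the nonzero positions bijectively onto the indices other than
   [i]. *)
rewrite -(big_neq_lift _ ord0 (fun k => indet i - indet (s k))) /c.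
rewrite [RHS](reindex_perm s); apply: eq_bigl => k.
by rewrite -si (inj_eq perm_inj).
Qed.
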